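(* Let $r\ge1$ and $0\le\theta\le1/(r+1)$. Then $f(r+1,\theta)=h(r,\theta)\ge H(r,\theta)$.
   Context: Preference orders: for a total order $<$ on $[m]$ and $k\in[m]$, ${\rm rpos}_<(k)=\frac1m|\{j\in[m]:j\le k\text{ in }<\}|$. An $(s,m)$-preference order is $P=(<_1,\dots,<_s)$, total orders on $[m]$; $x\in P$ means $x=({\rm rpos}_{<_1}(k),\dots,{\rm rpos}_{<_s}(k))$ for some $k$. For $x\in[0,1]^s$, $i_x=\min\{i:x_i=\max_jx_j\}$. For $0\le\theta\le1/s$: $f_P(\theta)=\max\{\prod_{i\ne i_x}x_i:x\in P,\ x\in[\theta,1]^s\}$, $f(s,\theta,m)=\min_Pf_P(\theta)$, $f(s,\theta)=\inf_mf(s,\theta,m)$. Covers: an $r$-cover is an $r$-uniform hypergraph $Q$ with $V(Q)\subset[0,1]$ whose edges form a perfect matching of $V(Q)$; $h(Q)=\max_{e\in E(Q)}\prod_{y\in e}y$. For $\theta\in[0,1/(r+1))$, an $(r,\theta,n)$-cover has $V(Q)=\{\theta+(\frac1{r+1}-\theta)\frac jn:j\in[rn]\}$; $h(r,\theta,n)=\min h(Q)$ over $(r,\theta,n)$-covers, $h(r,\theta)=\inf_nh(r,\theta,n)$, and $h(r,1/(r+1))=\lim_{\theta\to(1/(r+1))^-}h(r,\theta)=(r+1)^{-r}$. For $\theta\in[0,1/(r+1))$ let $w(r,\theta)=e^{-r}\bigl(u(1-\frac1{r+1}-(r-1)\theta)/u(\theta)\bigr)^{1/(\frac1{r+1}-\theta)}$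 with $u(y)=y^y$, $u(0)=1$; at $\theta=1/(r+1)$, $w(r,\theta)$ is taken to be its limit $(r+1)^{-r}$. Let $\phi_r$ be the smallest positive solution of $\theta(1-\frac1{r+1}-(r-1)\theta)^{r-1}=w(r,\theta)$. Define $H(r,\theta)=w(r,\phi_r)$ for $\theta\le\phi_r$ and $H(r,\theta)=w(r,\theta)$ for $\theta\ge\phi_r$. *)

(* Defs.v *)
From HB Require Import structures.
From mathcomp Require Import all_boot all_order all_algebra.
From mathcomp Require Import finmap.
From mathcomp Require Import all_classical all_reals all_analysis.

Set Implicit Arguments.
Unset Strict Implicit.
Unset Printing Implicit Defensive.

Import Order.TTheory GRing.Theory Num.Theory.
Import numFieldNormedType.Exports.

Local Open Scope classical_set_scope.
Local Open Scope ring_scope.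

Section MinMax.
Variable R : realType.

Definition setmin (A : set R) : R := get [set x | A x /\ lbound A x].
Definition setmax (A : set R) : R := get [set x | A x /\ ubound A x].

Lemma finite_setmax (A : set R) : finite_set A -> A !=set0 ->
  A (setmax A) /\ ubound A (setmax A).
Proof.
move=> /finite_fsetP[X ->] [x /= Xx].
suff /getPex : exists z, [set z | [set` X] z /\ ubound [set` X] z] z by [].
exists (val [arg max_(i > [` Xx]%fset) val i]%O).
case: arg_maxP => //= i _ iX; split; first exact: valP.
by move=> y /= Xy; exact: (iX [` Xy]%fset).
Qed.

Lemma finite_setmin (A : set R) : finite_set A -> A !=set0 ->
  A (setmin A) /\ lbound A (setmin A).
Proof.
move=> /finite_fsetP[X ->] [x /= Xx].
suff /getPex : exists z, [set z | [set` X] z /\ lbound [set` X] z] z by [].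
exists (val [arg min_(i < [` Xx]%fset) val i]%O).
case: arg_minP => //= i _ iX; split; first exact: valP.
by move=> y /= Xy; exact: (iX [` Xy]%fset).
Qed.

End MinMax.

Section PreferenceOrders.
Variable R : realType.

(* A total order [<] on [m] is represented by its reflexive closure [<=]
   (totality implies reflexivity); [m] is encoded as ['I_m]. *)
Definition is_total_order (m : nat) (le : rel 'I_m) : Prop :=
  [/\ antisymmetric le, transitive le & total le].

Definition rpos (m : nat) (le : rel 'I_m) (k : 'I_m) : R :=
  #|[pred j | le j k]|%:R / m%:R.

Definition preference_order (s m : nat) (P : 'I_s -> rel 'I_m) : Prop :=
  forall i, is_total_order (P i).

(* The set of all [x] with "x \in P". *)
Definition pref_points (s m : nat) (P : 'I_s -> rel 'I_m) : set ('I_s -> R) :=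
  [set x | exists k : 'I_m, x = (fun i => rpos (P i) k)].

(* [i_x], for [x] in [0,1]^s (so that 0 is neutral for the maximum); it is
   [None] only when [s = 0]. *)
Definition max_index (s : nat) (x : 'I_s -> R) : option 'I_s :=
  let M := \big[Num.max/0]_(j < s) x j in
  [pick i | (x i == M) && [forall j, (x j == M) ==> (i <= j)%N]].

Definition prod_but_max (s : nat) (x : 'I_s -> R) : R :=
  \prod_(i < s | Some i != max_index x) x i.

Definition pref_fP (s m : nat) (P : 'I_s -> rel 'I_m) (theta : R) : R :=
  setmax [set prod_but_max x | x in
    [set x | pref_points P x /\ forall i, theta <= x i <= 1]].

Definition pref_fm (s : nat) (theta : R) (m : nat) : R :=
  setmin [set pref_fP P theta | P in @preference_order s m].

Definition pref_f (s : nat) (theta : R) : R :=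
  inf [set pref_fm s theta m | m in [set m | (0 < m)%N]].

End PreferenceOrders.

Section Covers.
Variable R : realType.

Record hypergraph := Hypergraph {
  vertices : {fset R};
  edges : {fset {fset R}};
  _ : forall e, e \in edges -> (e `<=` vertices)%fset
}.

Definition hg_uniform (r : nat) (Q : hypergraph) : Prop :=
  forall e, e \in edges Q -> #|` e| = r.

Definition edges_perfect_matching (Q : hypergraph) : Prop :=
  forall v, v \in vertices Q -> exists! e, e \in edges Q /\ v \in e.

Definition is_cover (r : nat) (Q : hypergraph) : Prop :=
  [/\ hg_uniform r Q, forall v, v \in vertices Q -> 0 <= v <= 1
    & edges_perfect_matching Q].

Definition hQ (Q : hypergraph) : R :=
  setmax [set \prod_(y <- e) y | e in [set e | e \in edges Q]].

Definition cover_vertices (r : nat) (theta : R) (n : nat) : {fset R} :=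
  [fset (theta + (r.+1%:R^-1 - theta) * (j%:R / n%:R))%R
    | j in iota 1 (r * n)]%fset.

Definition is_theta_cover (r : nat) (theta : R) (n : nat) (Q : hypergraph)
    : Prop :=
  is_cover r Q /\ vertices Q = cover_vertices r theta n.

Definition cover_hn (r : nat) (theta : R) (n : nat) : R :=
  setmin [set hQ Q | Q in is_theta_cover r theta n].

Definition cover_h_lt (r : nat) (theta : R) : R :=
  inf [set cover_hn r theta n | n in [set n | (0 < n)%N]].

(* Used for 0 <= theta <= 1/(r+1); the endpoint value is the left limit. *)
Definition cover_h (r : nat) (theta : R) : R :=
  if theta < r.+1%:R^-1 then cover_h_lt r theta
  else lim (cover_h_lt r t @[t --> (r.+1%:R^-1)^'-]).

End Covers.

Section LowerBound.
Variable R : realType.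

(* [powR] satisfies [0 `^ 0 = 1]. *)
Definition u (y : R) : R := y `^ y.

Definition w_lt (r : nat) (theta : R) : R :=
  expR (- r%:R) *
  (u (1 - r.+1%:R^-1 - (r%:R - 1) * theta) / u theta)
    `^ (1 / (r.+1%:R^-1 - theta)).

(* Used for 0 <= theta <= 1/(r+1); the endpoint value is the left limit. *)
Definition w (r : nat) (theta : R) : R :=
  if theta < r.+1%:R^-1 then w_lt r theta
  else lim (w_lt r t @[t --> (r.+1%:R^-1)^'-]).

(* The endpoint 1/(r+1), always a solution, has to be included: it is the
   only positive solution when r = 1 or r = 2. *)
Definition phi (r : nat) : R :=
  setmin [set theta | 0 < theta <= r.+1%:R^-1 /\
    theta * (1 - r.+1%:R^-1 - (r%:R - 1) * theta) ^+ r.-1 = w r theta].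

Definition H (r : nat) (theta : R) : R :=
  if theta <= phi r then w r (phi r) else w r theta.

End LowerBound.

(* Main.v *)
(** With [a = 1/(r+1)], an item of a preference order that has a coordinate below
    [theta] does not count, and the largest coordinate of any other item is
    thrown away; at best the remaining coordinates fill each list from [theta] to
    [theta + r (a - theta)], that is, they form an [r]-cover. Conversely, rotating
    the edges of a cover through [r+1] lists gives a preference order. Both
    translations lose [O(1/m)], which disappears after replacing every item or
    edge by [T] consecutive copies and letting [T] tend to infinity.

    The largest product of a cover is at least the geometric mean of all the
    products, and comparing the sum of the logarithms of the vertices with
    [\int ln] gives [w r theta]. Since [pref_f] is antitone in [theta], the bound
    at [phi_r] is inherited by every smaller [theta]; only [phi_r <= a] matters,
    not the equation defining it. *)
Require Import Defs.
From mathcomp Require Import all_boot all_order all_algebra.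
From mathcomp Require Import finmap.
From mathcomp Require Import all_classical all_reals all_analysis.
From mathcomp Require Import zify lra.
Import Order.TTheory GRing.Theory Num.Theory.
Import numFieldNormedType.Exports.
Local Open Scope ring_scope.

Set Implicit Arguments.
Unset Strict Implicit.
Unset Printing Implicit Defensive.

(** * Packing of pairs into integers, and counting by injections *)

Lemma edivn_inj (d a b a' b' : nat) : (b < d)%N -> (b' < d)%N ->
  (a * d + b = a' * d + b')%N -> a = a' /\ b = b'.
Proof.
move=> bd bd' h; have := edivn_eq a bd; rewrite h edivn_eq // => -[-> ->].
by split.
Qed.

(** By cardinality the injection [p] is a bijection onto the integers below [#|K|], so each value
    below [c] is taken exactly once. *)
Lemma card_lt_injective (K : finType) (p : K -> nat) (c : nat) :
  injective p -> (forall k, p k < #|K|)%N -> (c <= #|K|)%N ->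
  #|[pred k | (p k < c)%N]| = c.
Proof.
move=> p_inj p_lt cK.
pose q k : 'I_#|K| := Ordinal (p_lt k).
have q_inj : injective q by move=> i j /(congr1 val)/p_inj.
have q_bij : bijective q by apply: (inj_card_bij q_inj); rewrite card_ord.
rewrite -[RHS](card_ord c) -sum1_card -(sum1_card 'I_c).
rewrite -(big_ord_narrow (F := fun=> 1%N) cK).
by rewrite (reindex q) //=; exact: onW_bij.
Qed.

(** * Preference orders as injective position functions *)

Section PreferencePositions.
Variable R : realType.

(** Nonnegativity makes the initial value [0] of the iterated maximum harmless, so some coordinate
    attains it, and the least such index qualifies. *)
Lemma max_index_ex (s : nat) (x : 'I_s.+1 -> R) :
  (forall i, 0 <= x i) -> exists i, max_index x = Some i.
Proof.
move=> x0; rewrite /max_index; set M := \big[_/_]_(j < _) _.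
have [i0 iM] : exists i, x i == M.
  case: (Order.TotalTheory.arg_maxP x (erefl : predT (ord0 : 'I_s.+1))) => i _ im.
  exists i; rewrite eq_le le_bigmax /=.
  by apply/bigmax_leP; split=> // j _; apply: im.
case: pickP => [i _|/= nM]; first by exists i.
case: (arg_minnP (fun i : 'I_s.+1 => val i) (iM : [pred i | x i == M] i0)) => i /= iM' im.
have := nM i; rewrite iM' /=; move/negbT/negP; case.
by apply/forallP => j; apply/implyP => /im.
Qed.

Lemma max_index_gt (s : nat) (x : 'I_s -> R) (i : 'I_s) :
  0 <= x i -> (forall j, j != i -> x j < x i) -> max_index x = Some i.
Proof.
move=> xi0 xi; rewrite /max_index; set M := \big[_/_]_(j < _) _.
have iM : M = x i.
  apply/eqP; rewrite eq_le le_bigmax andbT; apply/bigmax_leP; split=> // j _.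
  by have [->//|/xi/ltW] := eqVneq j i.
have xM j : (x j == M) = (j == i).
  rewrite iM; have [->|/xi/lt_eqF//] := eqVneq j i; exact: eqxx.
case: pickP => [j /andP[]|/(_ i)]; first by rewrite xM => /eqP->.
rewrite xM eqxx /= => /negbT/negP; case.
by apply/forallP => j; apply/implyP; rewrite xM => /eqP->.
Qed.

Lemma prod_but_max_neq (s : nat) (x : 'I_s -> R) (i : 'I_s) :
  max_index x = Some i -> prod_but_max x = \prod_(j < s | j != i) x j.
Proof.
move=> ix; rewrite /prod_but_max ix; apply: eq_bigl => j.
by congr negb; apply/eqP/eqP => [[]|->].
Qed.

Lemma prod_neq_lift (r : nat) (x : 'I_r.+1 -> R) (i : 'I_r.+1) :
  \prod_(j < r.+1 | j != i) x j = \prod_(t < r) x (lift i t).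
Proof.
rewrite big_mkcond (bigD1_ord i) //= eqxx mul1r; apply: eq_bigr => t _.
by rewrite eq_sym neq_lift.
Qed.

(** Such a [pos i] is a bijection onto the integers below [#|K|], that is, a total order on [K]
    given by positions counted from 0. Items may then be pairs or sums instead of elements of
    ['I_m]. *)
Definition positions (s : nat) (K : finType) (pos : 'I_s -> K -> nat) : Prop :=
  forall i, injective (pos i) /\ forall k, (pos i k < #|K|)%N.

Definition relpos (s : nat) (K : finType) (pos : 'I_s -> K -> nat) (k : K)
  (i : 'I_s) : R := (pos i k).+1%:R / #|K|%:R.

Lemma relpos_itv s (K : finType) (pos : 'I_s -> K -> nat) k i :
  positions pos -> 0 <= relpos pos k i <= 1.
Proof.
move=> posP; have [_ /(_ k) lt] := posP i.
have K0 : (0 < #|K|)%N by apply: leq_ltn_trans lt.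
by rewrite /relpos divr_ge0 //= ler_pdivrMr ?ltr0n // mul1r ler_nat.
Qed.

(** For [x > 0] the witness is the ceiling of [x] minus one, the number of positive integers
    strictly below [x]. *)
Lemma nat_ceil_pred (x : R) : 0 <= x ->
  exists c : nat, [/\ c%:R <= x, x <= c.+1%:R & c = 0%N \/ c%:R < x].
Proof.
move=> x0; have /andP[h1 h2] := truncn_itv x0; move: h1 h2.
case: (Num.trunc x) => [|c] h1 h2; first by exists 0%N; split; [|exact: ltW|left].
have [e|lt] := eqVneq x c.+1%:R; last first.
  by exists c.+1; split; [|exact: ltW|right; rewrite lt_neqAle eq_sym lt].
exists c; rewrite e; split=> //; first by rewrite ler_nat.
by right; rewrite ltr_nat.
Qed.

(* Each list has at most [c] items with relative position below [theta],
   so at most [s * c] items are discarded. *)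
Lemma card_good s (K : finType) (pos : 'I_s.+1 -> K -> nat) (theta : R) :
  positions pos -> (0 < #|K|)%N -> 0 <= theta -> s.+1%:R * theta <= 1 ->
  exists c : nat, [/\ c%:R <= theta * #|K|%:R, theta * #|K|%:R <= c.+1%:R,
    (s.+1 * c < #|K|)%N,
    (#|K| <= s.+1 * c + #|[set k | [forall i, theta <= relpos pos k i]%R]|)%N &
    forall k i, theta <= relpos pos k i -> (c <= pos i k)%N].
Proof.
move=> posP K0 t0 st1.
have m0 : 0 < #|K|%:R :> R by rewrite ltr0n.
have [c [c1 c2 c3]] : exists c : nat, [/\ c%:R <= theta * #|K|%:R,
    theta * #|K|%:R <= c.+1%:R & c = 0%N \/ c%:R < theta * #|K|%:R].
  by apply: nat_ceil_pred; rewrite mulr_ge0.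
(* Strictness guarantees a good item, even when [s.+1 * theta = 1]. *)
have scK : (s.+1 * c < #|K|)%N.
  case: c3 => [->|c3]; first by rewrite muln0.
  rewrite -(ltr_nat R) natrM.
  apply: (@lt_le_trans _ _ (s.+1%:R * (theta * #|K|%:R))).
    by rewrite ltr_pM2l // ltr0n.
  by rewrite mulrA ler_piMl // ltW.
exists c; split => //; last first.
  move=> k i; rewrite /relpos ler_pdivlMr // => tp.
  case: c3 => [->//|c3]; rewrite -ltnS -(ltr_nat R); exact: lt_le_trans tp.
pose bad i := [set k | (pos i k < c)%N].
have cK : (c <= #|K|)%N by apply: leq_trans (ltnW scK); rewrite leq_pmull.
have cbad i : #|bad i| = c.
  by have [inj lt] := posP i; rewrite cardsE (card_lt_injective inj lt cK).
set G := [set k | _].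
have sub : [set: K] \subset (\bigcup_i bad i) :|: G.
  apply/fintype.subsetP => k _; rewrite inE orbC inE.
  case: (boolP [forall i, _]) => //= /forallPn[i nk].
  apply/bigcupP; exists i => //; rewrite inE ltnNge; apply/negP => ck.
  move/negP: nk; apply; rewrite /relpos ler_pdivlMr //.
  by apply: le_trans c2 _; rewrite ler_nat ltnS.
have := subset_leq_card sub; rewrite cardsT => /leq_trans; apply.
apply: leq_trans (leq_card_setU _ _) _; rewrite leq_add2r.
have -> : (s.+1 * c = \sum_(i < s.+1) #|bad i|)%N.
  by rewrite (eq_bigr (fun=> c)) // sum_nat_const card_ord.
apply: (big_ind2 (fun (A : {set K}) n => (#|A| <= n)%N)) => [|A m B n Am Bn|//].
  by rewrite cards0.
by apply: leq_trans (leq_card_setU _ _) _; rewrite leq_add.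
Qed.
End PreferencePositions.

Section PreferenceValues.
Variables (R : realType) (s : nat) (theta : R).
Hypotheses (theta_ge0 : 0 <= theta) (theta_le : s.+1%:R * theta <= 1).

Definition order_position m (P : 'I_s.+1 -> rel 'I_m) i (k : 'I_m) : nat :=
  #|[pred j | P i j k]|.-1.

Lemma order_positionE m (P : 'I_s.+1 -> rel 'I_m) i k : preference_order P ->
  (order_position P i k).+1 = #|[pred j | P i j k]|.
Proof.
move=> PP; rewrite prednK //; apply/card_gt0P; exists k; rewrite inE.
by have [_ _ /(_ k k)] := PP i; rewrite orbb.
Qed.

Lemma order_positionP m (P : 'I_s.+1 -> rel 'I_m) : preference_order P ->
  positions (order_position P).
Proof.
move=> PP i; split=> [j k|k]; last first.
  by rewrite order_positionE // max_card.
move=> /(congr1 succn); rewrite !order_positionE // => jk.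
have [anti tr tot] := PP i.
(* The down-set of [a] lies in that of [b] and has the same size, so the two coincide; then [b] is
   below [a], and antisymmetry applies. *)
have key a b : P i a b -> #|[pred j | P i j a]| = #|[pred j | P i j b]| -> a = b.
  move=> ab /eqP; rewrite eqn_leq => /andP[_ ca].
  have sub : [pred j | P i j a] \subset [pred j | P i j b].
    by apply/fintype.subsetP => c; rewrite !inE => ac; exact: tr ac ab.
  have := subset_cardP _ sub; move=> /(_ _)/(_ b); rewrite !inE.
  move=> h; apply: anti; rewrite ab /= h //.
    by have := tot b b; rewrite orbb.
  by apply/eqP; rewrite eqn_leq ca subset_leq_card.
by have /orP[jk'|kj] := tot j k; [exact: key|apply/esym/key].
Qed.

Lemma rposE m (P : 'I_s.+1 -> rel 'I_m) i k : preference_order P ->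
  rpos R (P i) k = relpos R (order_position P) k i.
Proof. by move=> PP; rewrite /relpos order_positionE // card_ord. Qed.

Lemma rpos_relpos m (P : 'I_s.+1 -> rel 'I_m) k : preference_order P ->
  (fun i => rpos R (P i) k) = relpos R (order_position P) k.
Proof. by move=> PP; apply/funext => i; exact: rposE. Qed.

(** [card_good] supplies a good item, so [setmax] ranges over a nonempty finite set and is a true
    maximum, not a default value. *)
Lemma pref_fP_spec m (P : 'I_s.+1 -> rel 'I_m) : (0 < m)%N ->
  preference_order P ->
  (exists k, (forall i, theta <= relpos R (order_position P) k i) /\
     pref_fP P theta = prod_but_max (relpos R (order_position P) k)) /\
  forall k, (forall i, theta <= relpos R (order_position P) k i) ->
    prod_but_max (relpos R (order_position P) k) <= pref_fP P theta.
Proof.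
move=> m0 PP; rewrite /pref_fP; set A := (X in setmax X).
have posP := order_positionP PP.
have AE x : A x <-> exists2 k,
    (forall i, theta <= relpos R (order_position P) k i) &
    prod_but_max (relpos R (order_position P) k) = x.
  split=> [[y [[k ->] tk] <-]|[k tk <-]].
    by rewrite rpos_relpos //; exists k => // i; rewrite -rposE //; case/andP: (tk i).
  exists (fun i => rpos R (P i) k); last by rewrite rpos_relpos.
  split; first by exists k.
  by move=> i; rewrite rposE // tk; case/andP: (relpos_itv R k i posP).
have Afin : finite_set A.
  apply: (@sub_finite_set _ _
    ((fun k => prod_but_max (relpos R (order_position P) k)) @` setT)%classic).
    by move=> x /AE[k _ <-]; exists k.
  by apply: finite_image; exact: finite_finset.
have [] := @finite_setmax _ A Afin _.
  have K0 : (0 < #|'I_m|)%N by rewrite card_ord.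
  have [c [_ _ c1 c2 _]] := card_good posP K0 theta_ge0 theta_le.
  have : (0 < #|[set k | [forall i, theta <= relpos R (order_position P) k i]%R]|)%N by lia.
  rewrite card_gt0 => /set0Pn[k]; rewrite inE => /forallP tk.
  by exists (prod_but_max (relpos R (order_position P) k)); apply/AE; exists k.
move=> /AE[k tk <-] ub; split; first by exists k.
by move=> k' tk'; apply: ub; apply/AE; exists k'.
Qed.

Lemma pref_fm_spec m : (0 < m)%N ->
  (exists2 P : 'I_s.+1 -> rel 'I_m, preference_order P &
     pref_fm s.+1 theta m = pref_fP P theta) /\
  forall P : 'I_s.+1 -> rel 'I_m, preference_order P ->
     pref_fm s.+1 theta m <= pref_fP P theta.
Proof.
move=> m0; rewrite /pref_fm; set A := (X in setmin X).
have Afin : finite_set A.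
  (* Families of relations on ['I_m] are finite functions, so only finitely many values occur. *)
  pose g (F : {ffun 'I_s.+1 * 'I_m * 'I_m -> bool}) :=
    @pref_fP R s.+1 m (fun i j k => F (i, j, k)) theta.
  apply: (@sub_finite_set _ _ (g @` setT)%classic).
    move=> x [P PP <-]; exists [ffun x => P x.1.1 x.1.2 x.2] => //.
    rewrite /g; congr pref_fP.
    by apply/funext => i; apply/funext => j; apply/funext => k; rewrite ffunE.
  by apply: finite_image; exact: finite_finset.
have [] := @finite_setmin _ A Afin _.
  exists (pref_fP (fun (i : 'I_s.+1) (j k : 'I_m) => (j <= k)%N) theta).
  exists (fun (i : 'I_s.+1) (j k : 'I_m) => (j <= k)%N) => // i; split.
  - by move=> j k /anti_leq/val_inj.
  - by move=> j k l; exact: leq_trans.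
  - by move=> j k; exact: leq_total.
move=> [P PP PE] lb; split; first by exists P.
by move=> P' PP'; apply: lb; exists P'.
Qed.

Lemma pref_fm_attained m : (0 < m)%N ->
  exists2 pos : 'I_s.+1 -> 'I_m -> nat, positions pos &
  forall k, (forall i, theta <= relpos R pos k i) ->
    prod_but_max (relpos R pos k) <= pref_fm s.+1 theta m.
Proof.
move=> m0; have [[P PP ->] _] := pref_fm_spec m0.
by exists (order_position P); [exact: order_positionP|case: (pref_fP_spec m0 PP)].
Qed.

Lemma pref_fm_ge m (B : R) : (0 < m)%N ->
  (forall pos : 'I_s.+1 -> 'I_m -> nat, positions pos -> forall k,
    (forall i, theta <= relpos R pos k i) -> B <= prod_but_max (relpos R pos k)) ->
  B <= pref_fm s.+1 theta m.
Proof.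
move=> m0 hB; have [[P PP ->] _] := pref_fm_spec m0.
have [[k [tk ->]] _] := pref_fP_spec m0 PP.
by apply: hB => //; exact: order_positionP.
Qed.

(** Enumerating [K] transports the positions to an order on ['I_#|K|] with the same relative
    positions. *)
Lemma pref_fm_le (K : finType) (pos : 'I_s.+1 -> K -> nat) (B : R) :
  (0 < #|K|)%N -> positions pos ->
  (forall k, (forall i, theta <= relpos R pos k i) ->
     prod_but_max (relpos R pos k) <= B) ->
  pref_fm s.+1 theta #|K| <= B.
Proof.
move=> K0 posP hB.
pose P i (j k : 'I_#|K|) := (pos i (enum_val j) <= pos i (enum_val k))%N.
have PP : preference_order P.
  move=> i; have [inj _] := posP i; split.
  - by move=> j k /anti_leq/inj/enum_val_inj.
  - by move=> j k l; exact: leq_trans.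
  - by move=> j k; exact: leq_total.
have PE k : relpos R (order_position P) k = relpos R pos (enum_val k).
  apply/funext => i; have [inj lt] := posP i; rewrite /relpos card_ord.
  rewrite order_positionE //; congr (_%:R / _).
  transitivity #|[pred j : 'I_#|K| |
      (pos i (enum_val j) < (pos i (enum_val k)).+1)%N]|.
    by apply: eq_card => j; rewrite !inE.
  apply: (card_lt_injective (p := fun j : 'I_#|K| => pos i (enum_val j))).
  - by move=> j l /inj/enum_val_inj.
  - by move=> j; rewrite card_ord.
  - by rewrite card_ord.
have [_ /(_ P PP)/le_trans] := pref_fm_spec K0; apply.
have [[k [tk ->]] _] := pref_fP_spec K0 PP.
by rewrite PE; apply: hB => i; rewrite -PE.
Qed.

Lemma pref_fm_ge0 m : (0 < m)%N -> 0 <= pref_fm s.+1 theta m.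
Proof.
move=> m0; apply: pref_fm_ge => // pos posP k _.
by apply: prodr_ge0 => i _; case/andP: (relpos_itv R k i posP).
Qed.

Lemma pref_f_le_fm m : (0 < m)%N -> pref_f s.+1 theta <= pref_fm s.+1 theta m.
Proof.
move=> m0; apply: ge_inf; last by exists m.
by exists 0 => _ [k k0 <-]; exact: pref_fm_ge0.
Qed.

Lemma pref_f_ge (B : R) :
  (forall m, (0 < m)%N -> B <= pref_fm s.+1 theta m) -> B <= pref_f s.+1 theta.
Proof.
move=> hB; apply: lb_le_inf => [|_ [m m0 <-]]; last exact: hB.
by exists (pref_fm s.+1 theta 1); exists 1%N.
Qed.

End PreferenceValues.

(** A larger threshold leaves fewer items to maximise over. *)
Lemma pref_f_antitone (R : realType) (s : nat) (t theta : R) :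
  0 <= t -> t <= theta -> s.+1%:R * theta <= 1 ->
  pref_f s.+1 theta <= pref_f s.+1 t.
Proof.
move=> t0 tt st.
have st' : s.+1%:R * t <= 1 by apply: le_trans st; rewrite ler_wpM2l.
have theta0 : 0 <= theta by exact: le_trans tt.
apply: pref_f_ge => m m0.
apply: le_trans (pref_f_le_fm theta0 st m0) _.
have [pos posP hB] := pref_fm_attained t0 st' m0.
have := pref_fm_le (pos := pos) (B := pref_fm s.+1 t m) theta0 st _ posP.
rewrite card_ord; apply=> // k good; apply: hB => i; exact: le_trans (good i).
Qed.

(** * Covers as matchings of integers *)

(** Edges are labelled by [E] and the places within an edge by ['I_r]. By cardinality [sigma] is a
    bijection onto the vertex indices below [r * #|E|], hence a perfect matching of them. *)
Definition matching (r : nat) (E : finType) (sigma : E -> 'I_r -> nat) : Prop :=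
  injective (fun p : E * 'I_r => sigma p.1 p.2) /\
  forall e t, (sigma e t < r * #|E|)%N.

Lemma matching_surj r (E : finType) (sigma : E -> 'I_r -> nat) j :
  matching sigma -> (j < r * #|E|)%N -> exists e t, sigma e t = j.
Proof.
move=> [inj lt] jn.
pose f (p : E * 'I_r) : 'I_(r * #|E|) := Ordinal (lt p.1 p.2).
have f_inj : injective f by move=> p q /(congr1 val)/inj.
have [|g _ fK] := inj_card_bij f_inj.
  by rewrite card_ord card_prod card_ord mulnC.
by exists (g (Ordinal jn)).1, (g (Ordinal jn)).2; have /(congr1 val) := fK (Ordinal jn).
Qed.

Lemma trivial_matching r n : matching (fun (e : 'I_n) (t : 'I_r) => (t * n + e)%N).
Proof.
split=> [[e t] [e' t'] /= h|e t]; last first.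
  by rewrite card_ord; have := ltn_ord t; have := ltn_ord e; nia.
have [tt ee] := edivn_inj (ltn_ord e) (ltn_ord e') h.
by congr pair; exact: val_inj.
Qed.

Section CoverMatchings.
Variables (R : realType) (r : nat) (theta : R).
Hypotheses (r_gt0 : (0 < r)%N) (theta_lt : theta < r.+1%:R^-1).

(* The [j]-th vertex, counted from [0]. *)
Definition vertex (n j : nat) : R :=
  theta + (r.+1%:R^-1 - theta) * (j.+1%:R / n%:R).

Lemma vertex_inj n : (0 < n)%N -> injective (vertex n).
Proof.
move=> n0 i j /addrI /mulfI; rewrite subr_eq0 gt_eqF // => /(_ isT) /mulIf.
by rewrite invr_eq0 pnatr_eq0 -lt0n => /(_ n0) /eqP; rewrite eqr_nat => /eqP[].
Qed.

Lemma cover_verticesP n v :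
  reflect (exists2 j, (j < r * n)%N & v = vertex n j) (v \in cover_vertices r theta n).
Proof.
rewrite /cover_vertices; apply: (iffP (imfsetP _ _ _ _)) => [[[|j]]|[j jn ->]] /=.
- by rewrite mem_iota.
- by rewrite mem_iota => jn ->; exists j.
- by exists j.+1; rewrite //= mem_iota.
Qed.

Definition matching_edge n (E : finType) (sigma : E -> 'I_r -> nat) e : {fset R} :=
  [fset vertex n (sigma e t) | t in 'I_r]%fset.

Definition matching_edges n (E : finType) (sigma : E -> 'I_r -> nat) : {fset {fset R}} :=
  [fset matching_edge n sigma e | e in E]%fset.

Lemma matching_edge_prod (E : finType) (sigma : E -> 'I_r -> nat) e :
  (0 < #|E|)%N -> matching sigma ->
  \prod_(y <- matching_edge #|E| sigma e) y =
  \prod_(t < r) vertex #|E| (sigma e t).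
Proof.
move=> E0 [inj _]; rewrite big_imfset /=; last first.
  by move=> t t' _ _ /(vertex_inj E0) h; have [] := inj (e, t) (e, t') h.
by rewrite big_enum.
Qed.

Lemma top_vertex_le1 : 0 <= theta -> theta + (r.+1%:R^-1 - theta) * r%:R <= 1.
Proof.
move=> t0.
have : r%:R * r.+1%:R^-1 + r.+1%:R^-1 = 1 :> R.
  by rewrite -[X in _ + X]mul1r -mulrDl natr1 mulfV ?pnatr_eq0.
have : 0 <= theta * (r%:R - 1) by rewrite mulr_ge0 // subr_ge0 ler1n.
have : 0 <= r.+1%:R^-1 :> R by rewrite invr_ge0.
move: r.+1%:R^-1 r%:R => a b; nra.
Qed.

Lemma vertex_ge0 n j : 0 <= theta -> 0 <= vertex n j.
Proof.
by move=> t0; rewrite addr_ge0 // mulr_ge0 ?divr_ge0 // subr_ge0 ltW.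
Qed.

Lemma vertex_le_top n j : (0 < n)%N -> (j < r * n)%N ->
  vertex n j <= theta + (r.+1%:R^-1 - theta) * r%:R.
Proof.
move=> n0 jn; rewrite lerD2l ler_wpM2l //; first by rewrite subr_ge0 ltW.
by rewrite ler_pdivrMr ?ltr0n // -natrM ler_nat.
Qed.

Lemma vertex_le1 n j : 0 <= theta -> (0 < n)%N -> (j < r * n)%N -> vertex n j <= 1.
Proof.
by move=> t0 n0 jn; apply: le_trans (vertex_le_top n0 jn) (top_vertex_le1 t0).
Qed.

Lemma matching_cover (E : finType) (sigma : E -> 'I_r -> nat) :
  0 <= theta -> (0 < #|E|)%N -> matching sigma ->
  exists2 Q, is_theta_cover r theta #|E| Q & edges Q = matching_edges #|E| sigma.
Proof.
move=> t0 E0 sP; have [inj lt] := sP.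
have sub e : e \in matching_edges #|E| sigma -> (e `<=` cover_vertices r theta #|E|)%fset.
  move=> /imfsetP[/= e' _ ->]; apply/fsubsetP => v /imfsetP[/= t _ ->].
  by apply/cover_verticesP; exists (sigma e' t).
exists (Hypergraph sub) => //; split=> //; split.
- move=> e /imfsetP[/= e' _ ->]; rewrite card_in_imfset /=.
    by rewrite -cardE card_ord.
  by move=> t t' _ _ /(vertex_inj E0) h; have [] := inj (e', t) (e', t') h.
- by move=> v /cover_verticesP[j jn ->]; rewrite vertex_ge0 ?vertex_le1.
- move=> v /cover_verticesP[j jn ->] /=.
  have [e [t st]] := matching_surj sP jn.
  exists (matching_edge #|E| sigma e); split.
    split; first by apply/imfsetP; exists e.
    by apply/imfsetP; exists t => //=; rewrite st.
  move=> _ [/imfsetP[/= e' _ ->] /imfsetP[/= t' _ /(vertex_inj E0)]].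
  by rewrite -st => /(inj (e, t) (e', t')) [-> _].
Qed.

Lemma hQ_spec (Q : hypergraph R) : edges Q != fset0 ->
  (exists2 e, e \in edges Q & hQ Q = \prod_(y <- e) y) /\
  forall e, e \in edges Q -> \prod_(y <- e) y <= hQ Q.
Proof.
move=> /fset0Pn[e eQ]; rewrite /hQ; set A := (X in setmax X).
have [] := @finite_setmax _ A _ _.
- by apply: finite_image; exact: finite_fset.
- by exists (\prod_(y <- e) y); exists e.
move=> [e' e'Q <-] ub; split; first by exists e'.
by move=> e'' e''Q; apply: ub; exists e''.
Qed.

Lemma cover_hn_spec n : 0 <= theta -> (0 < n)%N ->
  (exists2 Q : hypergraph R, is_theta_cover r theta n Q & cover_hn r theta n = hQ Q) /\
  forall Q : hypergraph R, is_theta_cover r theta n Q -> cover_hn r theta n <= hQ Q.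
Proof.
move=> t0 n0; rewrite /cover_hn; set A := (X in setmin X).
have Afin : finite_set A.
  (* [hQ] depends on the edge set alone, which is a set of subsets of the fixed vertex set: finitely
     many choices. *)
  pose g (F : {fset {fset R}}) : R :=
    setmax [set \prod_(y <- e) y | e in [set e | e \in F]]%classic.
  apply: (@sub_finite_set _ _
    (g @` [set` fpowerset (fpowerset (cover_vertices r theta n))])%classic).
    move=> x [Q [_ QV] <-]; exists (edges Q) => //=.
    rewrite fpowersetE; apply/fsubsetP => e eQ; rewrite fpowersetE -QV.
    by case: Q QV eQ => V E EV _ /EV.
  by apply: finite_image; exact: finite_fset.
have [] := @finite_setmin _ A Afin _.
  have := @matching_cover 'I_n _ t0 _ (@trivial_matching r n).
  by rewrite card_ord => /(_ n0)[Q QP _]; exists (hQ Q); exists Q.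
move=> [Q QP <-] lb; split; first by exists Q.
by move=> Q' QP'; apply: lb; exists Q'.
Qed.

Lemma cover_hn_le (E : finType) (sigma : E -> 'I_r -> nat) (B : R) :
  0 <= theta -> (0 < #|E|)%N -> matching sigma ->
  (forall e, \prod_(t < r) vertex #|E| (sigma e t) <= B) ->
  cover_hn r theta #|E| <= B.
Proof.
move=> t0 E0 sP hB.
have [Q QP QE] := matching_cover t0 E0 sP.
have [_ /(_ _ QP)/le_trans] := cover_hn_spec t0 E0; apply.
have [] := @hQ_spec Q.
  have /card_gt0P[e _] := E0.
  apply/fset0Pn; exists (matching_edge #|E| sigma e); rewrite QE.
  by apply/imfsetP; exists e.
move=> [e]; rewrite QE => /imfsetP[/= e' _ ->] -> _.
by rewrite matching_edge_prod.
Qed.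

(** An optimal cover is read as a matching: [E] is its set of edges, and place [t] of an edge is the
    [t]-th element in its enumeration. *)
Lemma cover_hn_attained n : 0 <= theta -> (0 < n)%N ->
  exists (E : finType) (sigma : E -> 'I_r -> nat),
    [/\ #|E| = n, matching sigma &
      forall e, \prod_(t < r) vertex n (sigma e t) <= cover_hn r theta n].
Proof.
move=> t0 n0; have [[Q [[unif _ pm] QV] ->] _] := cover_hn_spec t0 n0.
have sub e : e \in edges Q -> (e `<=` vertices Q)%fset.
  by case: Q {unif pm QV} => V E EV /EV.
pose E : finType := edges Q.
pose elt (e : E) (t : 'I_r) : R := nth 0 (enum_fset (val e)) t.
have eltin e t : elt e t \in val e.
  by rewrite /elt mem_nth // (unif _ (valP e)).
have index e t : exists j, (j < r * n)%N && (elt e t == vertex n j).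
  have : elt e t \in vertices Q by apply: (fsubsetP (sub _ (valP e))); exact: eltin.
  by rewrite QV => /cover_verticesP[j jn ->]; exists j; rewrite jn eqxx.
pose sigma e t := ex_minn (index e t).
have sigmaP e t : (sigma e t < r * n)%N /\ elt e t = vertex n (sigma e t).
  by rewrite /sigma; case: ex_minnP => j /andP[jn /eqP].
(* A shared vertex forces equal edges by the perfect matching, then equal places because the
   enumeration has no repetition. *)
have inj : injective (fun p : E * 'I_r => sigma p.1 p.2).
  move=> [e t] [e' t'] /= /(congr1 (vertex n)).
  rewrite -(sigmaP e t).2 -(sigmaP e' t').2 => ee.
  have vV : elt e t \in vertices Q by apply: (fsubsetP (sub _ (valP e))); exact: eltin.
  have [f [_ fu]] := pm _ vV.
  have fe : f = val e by apply: fu; split; [exact: valP|exact: eltin].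
  have fe' : f = val e' by apply: fu; split; [exact: valP|rewrite ee; exact: eltin].
  have {fe fe'} e'e : e' = e by apply: val_inj; rewrite -fe -fe'.
  subst e'; congr pair; apply: val_inj; apply/eqP.
  rewrite -(nth_uniq 0 _ _ (fset_uniq (val e))) ?(unif _ (valP e)).
  - exact/eqP.
  - exact: ltn_ord.
  - exact: ltn_ord.
have En : #|E| = n.
  pose f (p : E * 'I_r) : 'I_(r * n) := Ordinal (sigmaP p.1 p.2).1.
  have f_inj : injective f by move=> p q /(congr1 val)/inj.
  have f_surj j : exists p, f p = j.
    have : vertex n j \in vertices Q by rewrite QV; apply/cover_verticesP; exists j.
    move=> /pm[e [[eQ je] _]].
    have ti : (seq.index (vertex n j) (enum_fset e) < r)%N.
      by move: je; rewrite -index_mem (unif _ eQ).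
    exists (([` eQ]%fset : E), Ordinal ti); apply: val_inj => /=.
    by apply: (@vertex_inj n n0); rewrite -(sigmaP _ _).2 /elt /= nth_index.
  have [g gK] := choice f_surj.
  have : #|{: E * 'I_r}| = #|'I_(r * n)|.
    by apply: (@bij_eq_card _ _ f); exists g => // p; apply: f_inj; rewrite gK.
  by rewrite card_prod !card_ord mulnC => /eqP; rewrite eqn_pmul2l // => /eqP.
exists E, sigma; split=> //; first by split=> // e t; rewrite En; case: (sigmaP e t).
move=> e; have [|_ /(_ _ (valP e))] := @hQ_spec Q.
  by apply/fset0Pn; exists (val e); exact: valP.
apply: le_trans; rewrite (big_nth 0) (unif _ (valP e)) big_mkord.
by rewrite le_eqVlt; apply/orP; left; apply/eqP/eq_bigr => t _; rewrite -(sigmaP e t).2.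
Qed.

End CoverMatchings.

(** * From preference orders to covers *)

Section RealBounds.
Variable R : realType.

(** Expanding the left side gives [2 ^+ n - 1] further terms, each at most [d] since all factors are
    at most 1. *)
Lemma prod_shift_le n (x : 'I_n -> R) (d : R) :
  (forall i, 0 <= x i <= 1) -> 0 <= d <= 1 ->
  \prod_(i < n) (x i + d) <= \prod_(i < n) x i + (2 ^+ n - 1) * d.
Proof.
move=> x01 /andP[d0 d1]; elim: n x x01 => [|n IHn] x x01.
  by rewrite !big_ord0 expr0 subrr mul0r addr0.
rewrite !big_ord_recl exprS; have /andP[a0 a1] := x01 ord0.
have Q01 : 0 <= \prod_(i < n) x (lift ord0 i) <= 1.
  rewrite prodr_ge0 => [|i _]; last by case/andP: (x01 (lift ord0 i)).
  by apply: Num.Theory.prodr_ile1 => i _; exact: x01.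
have := IHn (fun i => x (lift ord0 i)) (fun i => x01 _).
have : 1 <= 2 ^+ n :> R by rewrite exprn_ege1 // ler1n.
case/andP: Q01; set P := \prod_(i < n) (_ + d); set Q := \prod_(i < n) _.
move: (x ord0) a0 a1 (2 ^+ n) => a a0 a1 C Q0 Q1 C1 h.
apply: (@le_trans _ _ ((a + d) * (Q + (C - 1) * d))).
  by rewrite ler_wpM2l // addr_ge0.
have : 0 <= d * (1 - Q) by rewrite mulr_ge0 // subr_ge0.
have : 0 <= (1 - a) * ((C - 1) * d) by rewrite !mulr_ge0 // subr_ge0.
have : 0 <= (1 - d) * ((C - 1) * d) by rewrite !mulr_ge0 // subr_ge0.
nra.
Qed.

Lemma ler_addr_invn (x y C : R) :
  (forall n : nat, x <= y + C / n.+1%:R) -> x <= y.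
Proof.
move=> h; rewrite leNgt; apply/negP => yx.
have d0 : 0 < x - y by rewrite subr_gt0.
have C0 : 0 < C.
  by have := h 0%N; rewrite divr1 => xC; lra.
have /andP[_] := truncn_itv (ltW (divr_gt0 C0 d0)).
set n := Num.trunc _; rewrite ltr_pdivrMr // => Cn.
have := h n; rewrite -lerBlDl ler_pdivlMr ?ltr0n // => h'.
by have := lt_le_trans Cn (le_trans _ h'); rewrite mulrC lexx ltxx => /(_ isT).
Qed.

End RealBounds.

(** * Closing the gaps of an injective key *)

Section Rank.
Variables (T : finType) (key : T -> nat).
Hypothesis key_inj : injective key.

Definition rank p := #|[pred q | (key q < key p)%N]|.

Lemma rank_lt_card p : (rank p < #|T|)%N.
Proof.
apply: proper_card; apply/properP; split; first exact/fintype.subsetP.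
by exists p; rewrite // inE ltnn.
Qed.

Lemma rank_inj : injective rank.
Proof.
have mono p q : (key p < key q)%N -> (rank p < rank q)%N.
  move=> pq; apply: proper_card; apply/properP; split.
    by apply/fintype.subsetP => x; rewrite !inE => /ltn_trans; apply.
  by exists p; rewrite !inE // ltnn.
move=> p q; case: (ltngtP (key p) (key q)) => [/mono|/mono|/key_inj//] + e.
  by rewrite e ltnn.
by rewrite e ltnn.
Qed.

(** The keys below [key p] are distinct integers in the interval from [l] to [key p]. *)
Lemma rank_le p (l : nat) : (forall q, (l <= key q)%N) -> (l + rank p <= key p)%N.
Proof.
move=> lkey; rewrite -leq_subRL //.
rewrite /rank cardE -(size_map key) -(size_iota l (key p - l)).
apply: uniq_leq_size; first by rewrite map_inj_uniq ?enum_uniq.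
move=> _ /mapP[q + ->]; rewrite mem_enum inE mem_iota subnKC // => ->.
by rewrite lkey.
Qed.

End Rank.

Section CoverLePreference.
Variables (R : realType) (r : nat) (theta : R).
Hypotheses (r_gt0 : (0 < r)%N) (theta_ge0 : 0 <= theta)
  (theta_lt : theta < r.+1%:R^-1).

Lemma theta_mul_le1 : r.+1%:R * theta <= 1.
Proof. by rewrite mulrC -ler_pdivlMr ?ltr0n // mul1r ltW. Qed.

(* Replacing the positions of the remaining coordinates by their ranks gives a
   matching of [r n] consecutive integers, where [n] counts the good items. *)
Lemma cover_hn_le_positions (K : finType) (pos : 'I_r.+1 -> K -> nat)
    (i0 : K -> 'I_r.+1) (B : R) :
  (0 < #|K|)%N -> positions pos ->
  (forall k, (forall i, theta <= relpos R pos k i) ->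
    \prod_(t < r) relpos R pos k (lift (i0 k) t) <= B) ->
  exists2 n, (0 < n)%N & cover_hn r theta n <= B + 2 ^+ r / #|K|%:R.
Proof.
move=> K0 posP hB.
have [c [c1 c2 c3 c4 c5]] := card_good posP K0 theta_ge0 theta_mul_le1.
move: c4; set G := [set k | _] => c4.
pose E : finType := {k | k \in G}.
have GE : #|G| = #|E| by rewrite card_sig.
have E0 : (0 < #|E|)%N by lia.
have good (e : E) i : theta <= relpos R pos (val e) i.
  by have := valP e; rewrite inE => /forallP.
(* Lexicographic order on (position, list): equal positions in different lists are separated, and
   division by [r.+1] recovers the position. *)
pose key (p : E * 'I_r) : nat :=
  let i := lift (i0 (val p.1)) p.2 in (pos i (val p.1) * r.+1 + i)%N.
have key_inj : injective key.
  move=> [e t] [e' t']; rewrite /key /=.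
  set i := @lift r.+1 _ t; set i' := @lift r.+1 _ t' => h.
  have [pp /val_inj ii] := edivn_inj (ltn_ord i) (ltn_ord i') h.
  rewrite -ii in pp; have /val_inj ee := (posP i).1 _ _ pp.
  by move: ii; rewrite /i /i' -ee => /lift_inj ->.
pose sigma (e : E) t := rank key (e, t).
have sP : matching sigma.
  split=> [[e t] [e' t'] /= /(rank_inj key_inj)//|e t].
  by have := rank_lt_card key (e, t); rewrite card_prod card_ord mulnC.
exists #|E| => //.
apply: (cover_hn_le r_gt0 theta_lt theta_ge0 E0 sP) => e.
have m0 : 0 < #|K|%:R :> R by rewrite ltr0n.
have bound t : vertex r theta #|E| (sigma e t) <=
    relpos R pos (val e) (lift (i0 (val e)) t) + #|K|%:R^-1.
  have keyc q : (c * r.+1 <= key q)%N.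
    by apply: leq_trans (leq_addr _ _); rewrite leq_mul2r c5 ?orbT.
  set i := @lift r.+1 _ t.
  have kE : key (e, t) = (pos i (val e) * r.+1 + i)%N by [].
  have ck := rank_le key_inj (e, t) keyc; rewrite -/(sigma e t) kE in ck.
  have {}ck : (c * r.+1 + (sigma e t).+1 <= (pos i (val e)).+1 * r.+1)%N.
    by have := ltn_ord i; lia.
  rewrite /vertex /relpos; move: ck; move: (sigma e t).+1 (pos i _).+1 => k p ck.
  have s0 : 0 < r.+1%:R :> R by rewrite ltr0n.
  have n0 : 0 < #|E|%:R :> R by rewrite ltr0n.
  (* Few discarded items mean many edges; hence the spacing of the vertices is at most
     [1 / (r.+1 * #|K|)], which is [step]. *)
  have nE : (1 - r.+1%:R * theta) * #|K|%:R <= #|E|%:R.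
    move: c4; rewrite GE -(ler_nat R) natrD natrM.
    by have := ler_wpM2l (ltW s0) c1; lra.
  have ck' : c%:R + k%:R / r.+1%:R <= p%:R :> R.
    rewrite -(ler_pM2r s0) mulrDl divfK ?gt_eqF //.
    by rewrite -!natrM -natrD ler_nat.
  have step : (r.+1%:R^-1 - theta) * (k%:R / #|E|%:R) <=
      k%:R / r.+1%:R / #|K|%:R.
    rewrite ler_pdivlMr // mulrA mulrAC ler_pdivrMr //.
    have -> : (r.+1%:R^-1 - theta) * k%:R * #|K|%:R =
        k%:R / r.+1%:R * ((1 - r.+1%:R * theta) * #|K|%:R).
      have -> : r.+1%:R^-1 - theta = (1 - r.+1%:R * theta) / r.+1%:R.
        by rewrite mulrBl div1r [_ * theta]mulrC mulfK ?gt_eqF.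
      by move: r.+1%:R^-1 (1 - _) => x y; lra.
    by rewrite ler_wpM2l // divr_ge0 // ltW.
  apply: le_trans (lerD (lexx theta) step) _.
  rewrite -(ler_pM2r m0) !mulrDl divfK ?gt_eqF // mulVf ?gt_eqF //.
  rewrite divfK ?gt_eqF //; move: c2; rewrite -[c.+1%:R]natr1 => c2.
  by move: ck' c2; move: (k%:R / _) (theta * _) => x y; lra.
have r01 i : 0 <= relpos R pos (val e) i <= 1 by exact: relpos_itv.
have v0 t : 0 <= vertex r theta #|E| (sigma e t).
  exact: vertex_ge0.
apply: (@le_trans _ _ (\prod_(t < r)
    (relpos R pos (val e) (lift (i0 (val e)) t) + #|K|%:R^-1))).
  by apply: ler_prod => t _; rewrite v0 bound.
apply: le_trans (prod_shift_le _ _) _ => //.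
  by rewrite invr_ge0 ltW //= invf_le1 // ler1n.
rewrite lerD ?hB // ler_pM2r ?invr_gt0 // gerBl //; lra.
Qed.

Lemma cover_hn_ge0 n : (0 < n)%N -> 0 <= cover_hn r theta n.
Proof.
move=> n0; have [E [sigma [En _]]] := cover_hn_attained r_gt0 theta_lt theta_ge0 n0.
have /card_gt0P[e _] : (0 < #|E|)%N by rewrite En.
move=> /(_ e); apply: le_trans; apply: prodr_ge0 => t _.
exact: vertex_ge0.
Qed.

Lemma cover_h_lt_le n : (0 < n)%N -> cover_h_lt r theta <= cover_hn r theta n.
Proof.
move=> n0; apply: ge_inf; last by exists n.
by exists 0 => _ [k k0 <-]; exact: cover_hn_ge0.
Qed.

Lemma cover_h_lt_le_pref m : (0 < m)%N -> cover_h_lt r theta <= pref_fm r.+1 theta m.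
Proof.
move=> m0; apply: (@ler_addr_invn _ _ _ (2 ^+ r / m%:R)) => T.
have [pos posP posB] := pref_fm_attained theta_ge0 theta_mul_le1 m0.
have ex k : exists i, max_index (relpos R pos k) = Some i.
  by apply: max_index_ex => i; case/andP: (relpos_itv R k i posP).
have [i0 i0P] := choice ex.
(* Each item becomes [T.+1] consecutive copies. The last one keeps the relative position, the others
   lie lower, so good copies come from good items. *)
pose pos' i (p : 'I_m * 'I_T.+1) := (pos i p.1 * T.+1 + p.2)%N.
have K0 : (0 < #|{: 'I_m * 'I_T.+1}|)%N by rewrite card_prod !card_ord muln_gt0 m0.
have pos'P : positions pos'.
  move=> i; have [inj lt] := posP i; split=> [[k q] [k' q'] h|[k q]]; last first.
    rewrite card_prod !card_ord /pos' /=; move: (lt k); rewrite card_ord.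
    by have := ltn_ord q; nia.
  by have [] := edivn_inj (ltn_ord q) (ltn_ord q') h => /= /inj -> /val_inj ->.
have le k q i : relpos R pos' (k, q) i <= relpos R pos k i.
  rewrite /relpos card_prod !card_ord ler_pdivrMr ?ltr0n ?muln_gt0 ?m0 //.
  have -> : (pos i k).+1%:R / m%:R * (m * T.+1)%:R = ((pos i k).+1 * T.+1)%:R :> R.
    by rewrite !natrM mulrA divfK // pnatr_eq0 -lt0n.
  by rewrite ler_nat /pos' /=; have := ltn_ord q; nia.
(* From a copy the maximal coordinate of the original item is deleted, whichever coordinate is
   maximal for the copy itself. *)
have [|n n0 hn] := @cover_hn_le_positions _ pos' (i0 \o fst) (pref_fm r.+1 theta m) K0 pos'P.
  move=> [k q] good; apply: le_trans (posB k _) => [|i]; last first.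
    exact: le_trans (good i) (le _ _ _).
  rewrite (prod_but_max_neq (i0P k)) prod_neq_lift /=; apply: ler_prod => t _.
  have /andP[p0 _] := relpos_itv R (k, q) (lift (i0 k) t) pos'P.
  by apply/andP; split; [exact: p0|exact: le].
apply: le_trans (cover_h_lt_le n0) (le_trans hn _).
by rewrite card_prod !card_ord natrM invfM mulrA.
Qed.

End CoverLePreference.

(** * From covers to preference orders *)

Section PreferenceLeCover.
Variables (R : realType) (r : nat) (theta : R).
Hypotheses (r_gt0 : (0 < r)%N) (theta_ge0 : 0 <= theta)
  (theta_lt : theta < r.+1%:R^-1).

(* Each edge [e] yields [r.+1] items [(e, j)], whose [j]-th coordinate is large
   and whose other coordinates are the elements of [e], rotated cyclically so
   that every list uses every vertex exactly once. The [c * r.+1] further items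
   have one coordinate too small to count; their other coordinates occupy the
   top of the lists. With [d = i - j], this is the position in list [i]. *)
Definition item_position (E : finType) (sigma : E -> 'I_r -> nat) (c : nat)
    (k : (E * 'I_r.+1) + ('I_c * 'I_r.+1)) : nat :=
  match k with
  | inl (e, d) =>
      if unlift ord0 d is Some t then c + sigma e t
      else c + r * #|E| + enum_rank e
  | inr (q, d) =>
      if unlift ord0 d is Some t then c + r.+1 * #|E| + (t * c + q) else q
  end%N.

(** Subtraction is modulo [r.+1]; the offset 0 occurs exactly in list [j]. *)
Definition rotate_item (E : finType) (c : nat) (i : 'I_r.+1)
    (k : (E * 'I_r.+1) + ('I_c * 'I_r.+1)) : (E * 'I_r.+1) + ('I_c * 'I_r.+1) :=
  match k with
  | inl (e, j) => inl (e, i - j)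
  | inr (q, j) => inr (q, i - j)
  end.

Lemma card_items (E : finType) c :
  #|{: (E * 'I_r.+1) + ('I_c * 'I_r.+1)}| = ((#|E| + c) * r.+1)%N.
Proof. by rewrite card_sum !card_prod !card_ord mulnDl. Qed.

(** With [N = #|E|], the four cases fill disjoint consecutive blocks of lengths [c], [r * N], [N]
    and [r * c]: small coordinates of extra items, vertices, large coordinates, remaining
    coordinates of extra items. *)
Lemma item_position_inj (E : finType) (sigma : E -> 'I_r -> nat) c :
  matching sigma -> injective (item_position sigma (c := c)).
Proof.
move=> [inj lt].
have rank_lt (e : E) : (enum_rank e < #|E|)%N by exact: ltn_ord.
move=> [[e d]|[q d]] [[e' d']|[q' d']]; rewrite /item_position;
  case: (unliftP ord0 d) => [t|] ->; case: (unliftP ord0 d') => [t'|] -> h.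
- by have [-> ->] := inj (e, t) (e', t') (addnI h).
- by have := lt e t; lia.
- by have := lt e' t'; lia.
- by have /val_inj/enum_rank_inj -> := addnI h.
- by have := lt e t; lia.
- by have := ltn_ord q'; lia.
- by have := rank_lt e; lia.
- by have := ltn_ord q'; lia.
- by have := lt e' t'; lia.
- by have := rank_lt e'; lia.
- by have := ltn_ord q; lia.
- by have := ltn_ord q; lia.
- by have [/val_inj -> /val_inj ->] := edivn_inj (ltn_ord q) (ltn_ord q') (addnI h).
- by have := ltn_ord q'; lia.
- by have := ltn_ord q; lia.
- by have -> := val_inj h.
Qed.

Lemma item_position_lt (E : finType) (sigma : E -> 'I_r -> nat) c k :
  matching sigma -> (item_position sigma (c := c) k < (#|E| + c) * r.+1)%N.
Proof.
move=> [_ lt]; case: k => [[e d]|[q d]]; rewrite /item_position.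
  case: (unliftP ord0 d) => [t|] _; first by have := lt e t; nia.
  have : (enum_rank e < #|E|)%N by exact: ltn_ord.
  by nia.
case: (unliftP ord0 d) => [t|] _; last by have := ltn_ord q; nia.
have tq : (t * c + q < r * c)%N by have := ltn_ord q; have := ltn_ord t; nia.
by nia.
Qed.

Lemma rotate_item_inj (E : finType) c i : injective (@rotate_item E c i).
Proof.
move=> [[e j]|[q j]] [[e' j']|[q' j']] //; rewrite /rotate_item.
  move=> /(congr1 (fun s => if s is inl p then p else (e, i))) /eqP.
  by rewrite xpair_eqE => /andP[/eqP -> /eqP/addrI/oppr_inj ->].
move=> /(congr1 (fun s => if s is inr p then p else (q, i))) /eqP.
by rewrite xpair_eqE => /andP[/eqP -> /eqP/addrI/oppr_inj ->].
Qed.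

Lemma items_positions (E : finType) (sigma : E -> 'I_r -> nat) c :
  matching sigma ->
  positions (fun i k => item_position sigma (c := c) (rotate_item i k)).
Proof.
move=> sP i; split=> [|k]; last by rewrite card_items item_position_lt.
exact: inj_comp (item_position_inj sP) (@rotate_item_inj _ _ i).
Qed.

(** With [m = (n + c) * r.+1] items, the hypotheses on [c] place [theta * m] between [c] and [c.+1],
    so that a shift by [c] positions raises the vertices by about [theta]. *)
Lemma shifted_vertex_le (n c j : nat) : (0 < n)%N -> (j < r * n)%N ->
  c%:R * (1 - r.+1%:R * theta) <= r.+1%:R * theta * n%:R ->
  r.+1%:R * theta * n%:R <= c.+1%:R * (1 - r.+1%:R * theta) ->
  (c + j).+1%:R / ((n + c) * r.+1)%:R <= vertex r theta n j + n%:R^-1.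
Proof.
move=> n0 jn; have := vertex_le1 r_gt0 theta_lt theta_ge0 n0 jn.
have N0 : 0 < n%:R :> R by rewrite ltr0n.
have s0 : 0 < r.+1%:R :> R by rewrite ltr0n.
have D0 : 0 < 1 - r.+1%:R * theta.
  by rewrite subr_gt0 mulrC -ltr_pdivlMr // div1r.
have : vertex r theta n j * r.+1%:R * n%:R =
    r.+1%:R * theta * n%:R + (1 - r.+1%:R * theta) * j.+1%:R.
  rewrite /vertex.
  have -> : r.+1%:R^-1 - theta = (1 - r.+1%:R * theta) / r.+1%:R.
    by rewrite mulrBl div1r [_ * theta]mulrC mulfK ?gt_eqF.
  have -> : (theta + (1 - r.+1%:R * theta) / r.+1%:R * (j.+1%:R / n%:R)) *
      r.+1%:R * n%:R = theta * r.+1%:R * n%:R + (1 - r.+1%:R * theta) * j.+1%:R *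
      (r.+1%:R^-1 * r.+1%:R) * (n%:R^-1 * n%:R).
    by move: (1 - _) (r.+1%:R^-1) (n%:R^-1) => x y z; lra.
  by rewrite !mulVf ?gt_eqF // !mulr1 [theta * _]mulrC.
rewrite ler_pdivrMr ?ltr0n ?muln_gt0 ?addn_gt0 ?n0 // natrM natrD -addnS natrD.
rewrite -[c.+1%:R]natr1.
have nV : n%:R^-1 * n%:R = 1 :> R by rewrite mulVf ?gt_eqF.
have nV0 : 0 < n%:R^-1 :> R by rewrite invr_gt0.
have c0 : 0 <= c%:R :> R by [].
have := vertex_ge0 theta_lt n j theta_ge0.
move: (vertex _ _ _ _) => X X0 XE X1 h1 h2.
move: (r.+1%:R * theta) D0 XE h1 h2 => y D0 XE h1 h2.
rewrite -(ler_pM2r D0).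
move: r.+1%:R (n%:R) (n%:R^-1) c%:R j.+1%:R s0 N0 nV nV0 c0 XE X1 h1 h2.
move=> s N V C J s0 N0 nV nV0 c0 XE X1 h1 h2.
(* The goal, scaled by [1 - y], is linear in the products below: [p2] uses the lower bound on [c],
   and [p3] uses [X <= 1]. *)
have sD0 : 0 <= s * (1 - y) by rewrite mulr_ge0 ?ltW.
have p1 : 0 <= s * (1 - y) * (V * C) by rewrite !mulr_ge0 // ltW.
have p2 : 0 <= X * s * ((N + C) * (1 - y) - (N - (1 - y))).
  by rewrite !mulr_ge0 ?(ltW s0) // subr_ge0; lra.
have p3 : 0 <= s * (1 - y) * (1 - X) by rewrite mulr_ge0 // subr_ge0.
have p4 : s * (1 - y) * (V * N) = s * (1 - y) by rewrite nV mulr1.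
lra.
Qed.

Lemma pref_fm_le_matching (E : finType) (sigma : E -> 'I_r -> nat) (B : R) :
  (0 < #|E|)%N -> matching sigma ->
  (forall e, \prod_(t < r) vertex r theta #|E| (sigma e t) <= B) ->
  exists2 m, (0 < m)%N & pref_fm r.+1 theta m <= B + 2 ^+ r / #|E|%:R.
Proof.
move=> E0 sP hB.
have N0 : 0 < #|E|%:R :> R by rewrite ltr0n.
have s0 : 0 < r.+1%:R :> R by rewrite ltr0n.
have D0 : 0 < 1 - r.+1%:R * theta.
  by rewrite subr_gt0 mulrC -ltr_pdivlMr // div1r.
(* [z] solves [z = theta * r.+1 * (#|E| + z)]: it is the number of positions below the threshold
   once the extra items are included. *)
pose z := r.+1%:R * theta * #|E|%:R / (1 - r.+1%:R * theta).
have z0 : 0 <= z by rewrite divr_ge0 ?(ltW D0) // !mulr_ge0.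
have [c] := nat_ceil_pred z0; rewrite {z0}/z ler_pdivlMr // ler_pdivrMr // ltr_pdivlMr //.
move=> [c1 c2 c3].
pose K : finType := ((E * 'I_r.+1) + ('I_c * 'I_r.+1))%type.
pose pos i (k : K) := item_position sigma (rotate_item i k).
have posP : positions pos by exact: items_positions.
have K0 : (0 < #|K|)%N by rewrite card_items muln_gt0 addn_gt0 E0.
have m0 : 0 < #|K|%:R :> R by rewrite ltr0n.
exists #|K| => //.
apply: (pref_fm_le theta_ge0 (theta_mul_le1 theta_lt) K0 posP) => -[[e j]|[q j]] good.
- have ij : max_index (relpos R pos (inl (e, j))) = Some j.
    apply: max_index_gt => [|i ij].
      by case/andP: (relpos_itv R (inl (e, j)) j posP).
    rewrite /relpos ltr_pM2r ?invr_gt0 // ltr_nat ltnS /pos /= subrr unlift_none.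
    case: unliftP => [t _|/eqP]; last by rewrite subr_eq0 (negbTE ij).
    by apply: leq_trans (leq_addr _ _); rewrite ltn_add2l; exact: sP.2.
  rewrite (prod_but_max_neq ij).
  have -> : \prod_(i < r.+1 | i != j) relpos R pos (inl (e, j)) i =
      \prod_(t < r) ((c + sigma e t).+1%:R / #|K|%:R).
    (* Shifting the list index by [j] turns it into the offset, and the deleted list becomes offset
       0. *)
    rewrite (reindex_inj (@addIr _ j)) /=.
    rewrite (eq_bigl (fun i => i != ord0)) => [|i]; last first.
      by rewrite -[in RHS](inj_eq (@addIr _ j)) add0r.
    rewrite prod_neq_lift; apply: eq_bigr => t _.
    by rewrite /relpos /pos /= addrK liftK.
  apply: (@le_trans _ _ (\prod_(t < r) (vertex r theta #|E| (sigma e t) + #|E|%:R^-1))).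
    apply: ler_prod => t _; rewrite divr_ge0 //= card_items.
    by apply: shifted_vertex_le => //; exact: sP.2.
  apply: le_trans (prod_shift_le _ _) _ => [t||].
  + by rewrite vertex_ge0 // vertex_le1 //; exact: sP.2.
  + by rewrite invr_ge0 ltW //= invf_le1 // ler1n.
  + by rewrite lerD ?hB // ler_pM2r ?invr_gt0 // gerBl.
(* Coordinate [j] of an extra item is at most [c / #|K|], strictly below [theta]; if [c = 0] there
   is no extra item. *)
- have := good j; rewrite /relpos /pos /= subrr unlift_none.
  rewrite ler_pdivlMr // card_items.
  case: c3 => [c0|c3]; first by case: q {good} => q; rewrite c0.
  have qc : (q.+1)%:R <= c%:R :> R by rewrite ler_nat.
  move=> /le_trans/(_ qc); rewrite natrM natrD leNgt => /negP; case.
  by move: c3; move: #|E|%:R r.+1%:R => N s; lra.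
Qed.

Lemma pref_f_le_cover_hn n : (0 < n)%N -> pref_f r.+1 theta <= cover_hn r theta n.
Proof.
move=> n0; apply: (@ler_addr_invn _ _ _ (2 ^+ r / n%:R)) => T.
have [E [sigma [En sP hB]]] := cover_hn_attained r_gt0 theta_lt theta_ge0 n0.
(* Each edge becomes [T.+1] edges on the refined grid, whose vertices do not exceed the original
   ones. *)
pose sigma' (p : E * 'I_T.+1) t := (sigma p.1 t * T.+1 + p.2)%N.
have E'n : #|{: E * 'I_T.+1}| = (n * T.+1)%N by rewrite card_prod card_ord En.
have sP' : matching sigma'.
  split=> [[[e q] t] [[e' q'] t']|[e q] t]; rewrite /sigma' /=.
    move=> /(edivn_inj (ltn_ord q) (ltn_ord q'))[h /val_inj ->].
    by have [-> ->] := sP.1 (e, t) (e', t') h.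
  by rewrite E'n; have := sP.2 e t; rewrite En; have := ltn_ord q; nia.
have [||m m0 hm] := @pref_fm_le_matching _ sigma' (cover_hn r theta n) _ sP'.
- by rewrite E'n muln_gt0 n0.
- move=> [e q]; apply: le_trans (hB e); apply: ler_prod => t _.
  rewrite vertex_ge0 //= E'n lerD2l ler_wpM2l //; first by rewrite subr_ge0 ltW.
  rewrite ler_pdivrMr ?ltr0n ?muln_gt0 ?n0 // natrM mulrA divfK ?pnatr_eq0 -?lt0n //.
  by rewrite -natrM ler_nat /sigma' /=; have := ltn_ord q; nia.
rewrite E'n natrM invfM mulrA in hm; apply: le_trans hm.
exact: (pref_f_le_fm theta_ge0 (theta_mul_le1 theta_lt) m0).
Qed.

Lemma pref_f_eq_cover : pref_f r.+1 theta = cover_h_lt r theta.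
Proof.
apply/eqP; rewrite eq_le; apply/andP; split.
  apply: lb_le_inf => [|_ [n n0 <-]]; last exact: pref_f_le_cover_hn.
  by exists (cover_hn r theta 1); exists 1%N.
by apply: pref_f_ge => m; exact: cover_h_lt_le_pref.
Qed.

End PreferenceLeCover.

(** * The lower bound by the geometric mean *)

Section GeometricMean.
Variable R : realType.

(** The antiderivative of [ln]. *)
Definition lnint (y : R) : R := y * ln y - y.

(** [ln] is increasing, so its integral from [x] to [y] is at most the length times the value at
    [y], also with the sign reversed when [y < x]. It reduces to [ln t <= t - 1] at [t = y / x]. *)
Lemma lnint_le (x y : R) : 0 <= x -> 0 < y ->
  lnint y - lnint x <= (y - x) * ln y.
Proof.
move=> x0 y0; rewrite /lnint; have [->|xN0] := eqVneq x 0.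
  by rewrite mul0r; have := y0; lra.
have {xN0}x0 : 0 < x by rewrite lt0r xN0.
have : ln (y / x) <= y / x - 1.
  have -> : y / x = 1 + (y / x - 1) by rewrite addrC subrK.
  rewrite addrAC subrr add0r; apply: le_ln1Dx.
  by rewrite ltrBrDr addrC subrr divr_gt0.
rewrite ln_div ?posrE // -(ler_pM2l x0) !mulrBr mulr1 [x * (y / x)]mulrC divfK ?gt_eqF //.
lra.
Qed.

Lemma u_expR (y : R) : 0 <= y -> u y = expR (y * ln y).
Proof.
move=> y0; rewrite /u /powR; case: eqP => [->|//].
by rewrite mul0r expR0.
Qed.

Variables (r : nat) (theta : R).
Hypotheses (r_gt0 : (0 < r)%N) (theta_ge0 : 0 <= theta)
  (theta_lt : theta < r.+1%:R^-1).

Let a : R := r.+1%:R^-1.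
Let top : R := theta + (a - theta) * r%:R.

Let d_gt0 : 0 < a - theta. Proof. by rewrite subr_gt0. Qed.

Let top_gt : theta < top.
Proof. by rewrite ltrDl mulr_gt0 // ltr0n. Qed.

Lemma topE : 1 - r.+1%:R^-1 - (r%:R - 1) * theta = top.
Proof.
have : r%:R * a + a = 1.
  by rewrite -[X in _ + X]mul1r -mulrDl natr1 mulfV ?pnatr_eq0.
by rewrite /top -/a; move: a r%:R => x y; lra.
Qed.

(** The factor [expR (- r%:R)] supplies the linear terms of [lnint], because
    [top - theta = r * (a - theta)]. Thus [w] is the exponential of [r] times the mean of [ln] on
    the interval from [theta] to [top]. *)
Lemma w_ltE : w_lt r theta = expR ((lnint top - lnint theta) / (a - theta)).
Proof.
have top_ge0 : 0 <= top by apply: le_trans (ltW top_gt).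
rewrite /w_lt topE !u_expR // -expRN -expRD -/a div1r.
rewrite -expRM -expRD; congr expR.
rewrite /lnint -[- r%:R](mulfK (lt0r_neq0 d_gt0)) -mulrDl; congr (_ / _).
by rewrite /top; lra.
Qed.

Lemma exp_le_w_lt : theta ^+ r <= w_lt r theta.
Proof.
have [->|tN0] := eqVneq theta 0.
  by rewrite expr0n gtn_eqF // mulr_ge0 ?expR_ge0 ?powR_ge0.
have t0 : 0 < theta by rewrite lt0r tN0.
have top0 : 0 < top by apply: lt_trans top_gt.
rewrite w_ltE -[theta in X in X <= _]lnK ?posrE // -expRM_natr ler_expR.
rewrite ler_pdivlMr // -mulrA [r%:R * _]mulrC.
(* Applied with the endpoints reversed: on the interval [ln] is at least [ln theta]. *)
have := lnint_le (ltW top0) t0.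
have -> : theta - top = - ((a - theta) * r%:R) by rewrite /top; lra.
by move: (_ * r%:R) => x; lra.
Qed.

Lemma w_lt_le_cover_hn n : (0 < n)%N -> w_lt r theta <= cover_hn r theta n.
Proof.
move=> n0; have [E [sigma [En sP hB]]] := cover_hn_attained r_gt0 theta_lt theta_ge0 n0.
have N0 : 0 < n%:R :> R by rewrite ltr0n.
have v0 j : 0 < vertex r theta n j.
  by rewrite ltr_wpDl // mulr_gt0 // divr_gt0 ?ltr0n.
have prodE : \prod_(e : E) \prod_(t < r) vertex r theta n (sigma e t) =
    \prod_(j < r * n) vertex r theta n j.
  rewrite pair_bigA /=; have [inj lt] := sP.
  rewrite En in lt.
  pose f (p : E * 'I_r) : 'I_(r * n) := Ordinal (lt p.1 p.2).
  have f_inj : injective f by move=> p q /(congr1 val)/inj.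
  rewrite [RHS](reindex f) //=; apply: onW_bij; apply: (inj_card_bij f_inj).
  by rewrite card_ord card_prod card_ord En mulnC.
(* Here [y 0 = theta] and [y k.+1] is vertex [k], so the sum of [ln] over the vertices is a right
   Riemann sum, bounded below by telescoping. *)
pose y k : R := theta + (a - theta) * (k%:R / n%:R).
have step k : (a - theta) / n%:R * ln (y k.+1) >= lnint (y k.+1) - lnint (y k).
  have -> : (a - theta) / n%:R = y k.+1 - y k.
    by rewrite /y -natr1; lra.
  apply: lnint_le; last exact: v0.
  by rewrite addr_ge0 // mulr_ge0 ?divr_ge0 // ltW.
have tele m : lnint (y m) - lnint theta <=
    (a - theta) / n%:R * \sum_(j < m) ln (y j.+1).
  elim: m => [|m IHm].
    by rewrite big_ord0 mulr0 /y mul0r mulr0 addr0 subrr.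
  by rewrite big_ord_recr /= mulrDr; have := step m; lra.
have h0 := cover_hn_ge0 r_gt0 theta_ge0 theta_lt n0.
rewrite -(ler_pXn2r n0) ?nnegrE //; last by rewrite w_ltE expR_ge0.
have le1 : \prod_(j < r * n) vertex r theta n j <= cover_hn r theta n ^+ n.
  rewrite -prodE -[X in _ ^+ X]En -prodr_const; apply: ler_prod => e _.
  by rewrite hB andbT prodr_ge0 // => t _; exact: ltW.
apply: le_trans le1.
have -> : \prod_(j < r * n) vertex r theta n j = expR (\sum_(j < r * n) ln (y j.+1)).
  by rewrite expR_sum; apply: eq_bigr => j _; rewrite lnK // posrE v0.
rewrite w_ltE -expRM_natr ler_expR mulrAC ler_pdivrMr // -ler_pdivlMr //.
have := tele (r * n)%N.
have -> : y (r * n)%N = top by rewrite /y natrM mulfK ?gt_eqF.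
by move=> /le_trans; apply; rewrite mulrAC [_ * (a - theta)]mulrC.
Qed.

Lemma w_lt_le_cover_h_lt : w_lt r theta <= cover_h_lt r theta.
Proof.
apply: lb_le_inf => [|_ [n n0 <-]]; last exact: w_lt_le_cover_hn.
by exists (cover_hn r theta 1); exists 1%N.
Qed.

(** The cover with [n = 1] has a single edge, whose vertices are all at most the top one. *)
Lemma cover_h_lt_le_exp : cover_h_lt r theta <= (theta + (r.+1%:R^-1 - theta) * r%:R) ^+ r.
Proof.
apply: le_trans (cover_h_lt_le r_gt0 theta_ge0 theta_lt (ltn0Sn 0)) _.
have sP := trivial_matching r 1.
have E0 : (0 < #|'I_1|)%N by rewrite card_ord.
rewrite -[X in cover_hn _ _ X](card_ord 1).
apply: (cover_hn_le r_gt0 theta_lt theta_ge0 E0 sP) => e.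
rewrite -[X in _ ^+ X](card_ord r) -prodr_const; apply: ler_prod => t _.
by rewrite vertex_ge0 //= vertex_le_top //; exact: sP.2.
Qed.

End GeometricMean.

(** * The endpoint 1/(r+1) *)

Section Endpoint.
Variables (R : realType) (r : nat).
Hypothesis r_gt0 : (0 < r)%N.

Let a : R := r.+1%:R^-1.

Let a_gt0 : 0 < a. Proof. by rewrite invr_gt0 ltr0n. Qed.

Local Open Scope classical_set_scope.

Let near_lt : \forall t \near a^'-, 0 <= t < a.
Proof.
near=> t; apply/andP; split.
  by near: t; exact: nbhs_left_ge.
by near: t; exact: nbhs_left_lt.
Unshelve. all: by end_near. Qed.

Let lower_cvg : (t ^+ r) @[t --> a^'-] --> a ^+ r.
Proof. by apply: cvg_at_left_filter; exact: exprn_continuous. Qed.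

Let upper_cvg : ((t + (a - t) * r%:R) ^+ r) @[t --> a^'-] --> a ^+ r.
Proof.
apply: cvg_at_left_filter.
have h : (t + (a - t) * r%:R) @[t --> a] --> a.
  rewrite -[X in _ --> X]addr0 -[X in _ --> _ + X](mul0r r%:R) -[X in X * _](subrr a).
  by apply: cvgD; [exact: cvg_id|apply: cvgM; [apply: cvgB; [exact: cvg_cst|exact: cvg_id]|exact: cvg_cst]].
exact: (continuous_cvg _ (@exprn_continuous R r a) h).
Qed.

(** Squeezed between the [r]-th powers of the two ends of the vertex interval, which shrinks to
    [a]. *)
Lemma cover_h_lt_cvg : cover_h_lt r t @[t --> a^'-] --> a ^+ r.
Proof.
apply: (squeeze_cvgr _ lower_cvg upper_cvg); near=> t.
have /andP[t0 ta] : 0 <= t < a by near: t.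
rewrite (le_trans (exp_le_w_lt r_gt0 t0 ta) (w_lt_le_cover_h_lt r_gt0 t0 ta)).
exact: cover_h_lt_le_exp.
Unshelve. all: by end_near. Qed.

Lemma w_lt_cvg : w_lt r t @[t --> a^'-] --> a ^+ r.
Proof.
apply: (squeeze_cvgr _ lower_cvg cover_h_lt_cvg); near=> t.
have /andP[t0 ta] : 0 <= t < a by near: t.
by rewrite (exp_le_w_lt r_gt0 t0 ta) (w_lt_le_cover_h_lt r_gt0 t0 ta).
Unshelve. all: by end_near. Qed.

Lemma cover_h_endpoint : cover_h r a = a ^+ r.
Proof. by rewrite /cover_h ltxx; apply/cvg_lim => //; exact: cover_h_lt_cvg. Qed.

Lemma w_endpoint : w r a = a ^+ r.
Proof. by rewrite /w ltxx; apply/cvg_lim => //; exact: w_lt_cvg. Qed.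

Let a_mul_le1 : r.+1%:R * a <= 1.
Proof. by rewrite mulfV ?pnatr_eq0. Qed.

Lemma pref_f_endpoint : pref_f r.+1 a = a ^+ r.
Proof.
apply/eqP; rewrite eq_le; apply/andP; split.
  (* Antitonicity bounds the value at [a] by the values at smaller [t], which converge to
     [a ^+ r]. *)
  apply: (cvgr_to_ge cover_h_lt_cvg); near=> t.
  have /andP[t0 ta] : 0 <= t < a by near: t.
  by rewrite -pref_f_eq_cover //; apply: pref_f_antitone => //; exact: ltW.
(* Conversely, every coordinate of a good item is at least [a]. *)
apply: pref_f_ge => m m0.
apply: (pref_fm_ge (ltW a_gt0) a_mul_le1 m0) => pos posP k good.
have [|i /prod_but_max_neq ->] := @max_index_ex R r (relpos R pos k).
  by move=> i; case/andP: (relpos_itv R k i posP).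
rewrite prod_neq_lift -[X in _ ^+ X](card_ord r) -prodr_const.
by apply: ler_prod => t _; rewrite ltW //= good.
Unshelve. all: by end_near. Qed.

Lemma pref_f_eq_cover_h (theta : R) : 0 <= theta <= a ->
  pref_f r.+1 theta = cover_h r theta.
Proof.
case/andP=> t0; rewrite le_eqVlt => /orP[/eqP ->|ta].
  by rewrite pref_f_endpoint cover_h_endpoint.
by rewrite /cover_h ta pref_f_eq_cover.
Qed.

Lemma w_le_pref_f (theta : R) : 0 <= theta <= a -> w r theta <= pref_f r.+1 theta.
Proof.
case/andP=> t0; rewrite le_eqVlt => /orP[/eqP ->|ta].
  by rewrite pref_f_endpoint w_endpoint.
by rewrite /w ta pref_f_eq_cover // w_lt_le_cover_h_lt.
Qed.

End Endpoint.

(* Should the set defining [phi] have no minimum, [phi] would be the default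
   value [0]. *)
Lemma phi_le (R : realType) (r : nat) : phi R r <= r.+1%:R^-1.
Proof.
rewrite /phi /setmin; set P := (X in get X).
have [ex|nex] := pselect (exists x, P x).
  by have [[/andP[]]] := getPex ex.
by rewrite getPN ?invr_ge0 // => x Px; apply: nex; exists x.
Qed.

Unset Implicit Arguments.

Theorem theorem7p16 (R : realType) (r : nat) (theta : R)
    (hr : (1 <= r)%N) (htheta : 0 <= theta <= r.+1%:R^-1) :
  pref_f r.+1 theta = cover_h r theta /\ cover_h r theta >= H r theta.
Proof.
have fh := pref_f_eq_cover_h hr htheta; split=> //.
rewrite -fh /H; case: ifP => [tphi|_]; last exact: w_le_pref_f.
have /andP[t0 _] := htheta.
(* In this branch [phi] is nonnegative because [0 <= theta <= phi]. *)
have phi_itv : 0 <= phi R r <= r.+1%:R^-1 by rewrite (le_trans t0 tphi) phi_le.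
apply: le_trans (w_le_pref_f hr phi_itv) _.
apply: pref_f_antitone => //.
by rewrite mulrC -ler_pdivlMr ?ltr0n // mul1r phi_le.
Qed.
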